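(* Let $X$ be a Fréchet space, $(p_n)_{n\ge1}$ an increasing sequence of seminorms defining the topology of $X$, $Y$ a separable topological vector space whose topology is defined by a sequence of seminorms, and $(T_n)_{n\ge1}$ a sequence of continuous linear operators from $X$ to $Y$. If there exist a sequence $(E_n)_{n\ge1}$ of closed subspaces of finite codimension in $X$, positive numbers $C_n\to\infty$ and a continuous seminorm $q$ on $Y$ such that for any $n\ge1$ and any $x\in E_n$, $$q(T_nx)\ge C_np_n(x),$$ then $(T_n)$ does not possess any hypercyclic subspace of type $1$.
   Context: A vector $x\in X$ is hypercyclic for $(T_n)$ if $\{T_nx\}_n$ is dense in $Y$. A hypercyclic subspace for $(T_n)$ is a closed infinite-dimensional subspace $M$ of $X$ in which every non-zero vector is hypercyclic for $(T_n)$. A hypercyclic subspace $M$ is of type $1$ if there exists a continuous seminorm $p$ on $X$ such that $M\cap\ker p=\{0\}$. *)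

(* Defs.v *)
From mathcomp Require Import all_boot all_order all_algebra.
From mathcomp Require Import all_classical all_reals all_analysis.
From mathcomp Require Export complex.
Import Order.TTheory GRing.Theory Num.Theory.
Import numFieldTopology.Exports.

Set Implicit Arguments.
Unset Strict Implicit.
Unset Printing Implicit Defensive.

Local Open Scope classical_set_scope.
Local Open Scope ring_scope.

(* Sequences (x_n)_{n >= 1} are indexed by nat, the value at k : nat being
   x_{k+1}. *)

Definition real_or_complex (R : realType) (K : numFieldType) : Prop :=
  K = (R : numFieldType) \/ K = (R[i] : numFieldType).

Section Seminorms.
Context {K : numFieldType}.

(* Like the norms of the library, seminorms take their values in the scalar
   field; if K is complex, 0 <= p x says that p x is real and nonnegative. *)
Definition seminorm (X : lmodType K) (p : X -> K) : Prop :=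
  [/\ forall x, 0 <= p x,
      forall x y, p (x + y) <= p x + p y &
      forall (a : K) x, p (a *: x) = `|a| * p x].

Definition continuous_seminorm (X : topologicalLmodType K) (p : X -> K) : Prop :=
  seminorm p /\ continuous p.

(* The topology is the one generated by the sequence p: finite intersections of
   balls { y | p_i (y - x) < e } form a basis of neighbourhoods of x. *)
Definition defines_topology (X : topologicalLmodType K) (p : nat -> X -> K) :
    Prop :=
  forall (x : X) (U : set X),
    nbhs x U <->
    exists s : seq nat, exists2 e : K, 0 < e &
      [set y | forall i, i \in s -> p i (y - x) < e] `<=` U.

Definition increasing_seminorms (X : Type) (p : nat -> X -> K) : Prop :=
  forall n x, p n x <= p n.+1 x.

(* The notion of the library, cauchy, refers to a uniform structure which tvsType
   does not relate to the vector space structure. *)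
Definition cauchy_seq (X : topologicalLmodType K) (u : nat -> X) : Prop :=
  forall U : set X, nbhs 0 U ->
    exists N, forall m n, (N <= m)%N -> (N <= n)%N -> U (u m - u n).

Definition frechet_space (X : topologicalLmodType K) : Prop :=
  [/\ hausdorff_space X,
      exists2 p : nat -> X -> K, (forall n, seminorm (p n)) & defines_topology p &
      forall u : nat -> X, cauchy_seq u -> exists l : X, u n @[n --> \oo] --> l].

Definition separable_space (Y : topologicalType) : Prop :=
  exists2 D : set Y, countable D & dense D.

Definition vector_subspace (X : lmodType K) (E : set X) : Prop :=
  submod_closed [in E].

Definition finite_codimensional (X : lmodType K) (E : set X) : Prop :=
  exists (d : nat) (v : 'I_d -> X), forall x, exists a : 'I_d -> K,
    E (x - \sum_(i < d) a i *: v i).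

Definition finite_dimensional (X : lmodType K) (M : set X) : Prop :=
  exists (d : nat) (v : 'I_d -> X), (forall i, M (v i)) /\
    forall x, M x -> exists a : 'I_d -> K, x = \sum_(i < d) a i *: v i.

Definition hypercyclic_vector (X Y : topologicalLmodType K)
    (T : nat -> {linear X -> Y}) (x : X) : Prop :=
  dense (range (fun n => T n x)).

Definition hypercyclic_subspace (X Y : topologicalLmodType K)
    (T : nat -> {linear X -> Y}) (M : set X) : Prop :=
  [/\ vector_subspace M, closed M, ~ finite_dimensional M &
      forall x, M x -> x != 0 -> hypercyclic_vector T x].

Definition hypercyclic_subspace_type1 (X Y : topologicalLmodType K)
    (T : nat -> {linear X -> Y}) (M : set X) : Prop :=
  hypercyclic_subspace T M /\
  exists2 p : X -> K, continuous_seminorm p & M `&` [set x | p x = 0] = [set 0].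

End Seminorms.

(* Main.v *)
Require Import Defs.
From mathcomp Require Import all_boot all_order all_algebra.
From mathcomp Require Import all_classical all_reals all_analysis.
From mathcomp Require Import ring.
Import Order.TTheory GRing.Theory Num.Theory.
Import numFieldTopology.Exports.

Set Implicit Arguments.
Unset Strict Implicit.

Local Open Scope classical_set_scope.
Local Open Scope ring_scope.

(** Why the theorem holds.  Put Q_n = q o T_n, a continuous seminorm on X, and let
M be a candidate subspace of type 1.  It suffices to find l in M with
Q_n l >= 1 for all n >= n_0: the values q (T_n l), n < n_0, being finitely many,
there is then an interval ]0, e[ which q takes no value in along the orbit of l,
whereas q takes values in it on Y, so that the orbit is not dense
(not_dense_seminorm_ge1).

Type 1 means that some p_N is a norm on M (continuous_seminorm_ker).  Cut the
indices n >= n_0 into blocks b_k <= n < b_(k+1) with C_n >= 2 * 2^k from b_k on,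
and build l as the sum of vectors x_k of M with p_(b_k) x_k = 2^-k.  Since
b_k >= k, these series converge.  If x_k lies in E_n for the n of block k, then
Q_n x_k >= C_n p_n x_k >= C_n p_(b_k) x_k >= 2, so that block k is served by
x_k, provided that neither the earlier nor the later terms spoil this bound.
Smallness of the later terms does not help here, because nothing bounds Q_n by
p_(b_k).  They are chosen instead in a hyperplane on which Q_n cannot drop:
by Hahn-Banach applied to Q_n at the partial sum s_k, there is a subspace L of
codimension at most 1 with Q_n s_k <= Q_n (s_k + x) for all x in L.  If x_k is
in these subspaces for all n < b_(k+1), then Q_n s_k is nondecreasing in k as
soon as n < b_(k+1).  Moreover
Q_n x_k <= Q_n s_(k+1) + Q_n s_k <= 2 Q_n s_(k+1), which takes care of the
earlier terms: Q_n s_(k+1) >= 1 on block k, and this passes to the limit.  Each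
x_k exists because finitely many subspaces of finite codimension meet an
infinite-dimensional space in a nonzero vector (exists_next_term).

The scalars K are real or complex.  Hahn-Banach is a statement about real
scalars, and so the subspaces L are only stable under the real elements of K.
This is harmless: intersecting with a real hyperplane does not make an
infinite-dimensional space finite-dimensional. *)

(** * The real elements of the scalar field *)

Section RealScalars.
Variables (R : realType) (K : numFieldType).
Hypothesis hK : real_or_complex R K.

(** The one place where the two cases for K are told apart; order completeness and
the Archimedean property of the real elements of K are transported along iota. *)
Lemma real_scalars_embedding :
  exists iota : {rmorphism R -> K}, {mono iota : x y / x <= y} /\
    forall k, k \is Num.real -> exists r, k = iota r.
Proof.
case: hK => ->.
  by exists (idfun : {rmorphism R -> R}); split => // k _; exists k.
exists (real_complex R : {rmorphism R -> R[i]}); split; first exact: lecR.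
by move=> k /complex_realP.
Qed.

(** Dedekind completeness in the form in which the one-step extension of
Hahn-Banach consumes it. *)
Lemma real_cut (A B : set K) :
  A `<=` [set a | a \is Num.real] -> B `<=` [set b | b \is Num.real] ->
  A !=set0 -> B !=set0 -> (forall a b, A a -> B b -> a <= b) ->
  exists2 c, c \is Num.real &
    (forall a, A a -> a <= c) /\ (forall b, B b -> c <= b).
Proof.
have [iota [le_iota realK]] := real_scalars_embedding => Areal Breal A0 [b0 Bb0] AB.
have [r0 br0] := realK _ (Breal _ Bb0).
pose A' := [set r | A (iota r)].
have A'0 : A' !=set0.
  by have [a Aa] := A0; have [r ar] := realK _ (Areal _ Aa); exists r; rewrite /A' /= -ar.
have A'ub : has_ubound A'.
  by exists r0 => r Ar; rewrite -le_iota -br0; exact: AB.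
exists (iota (sup A')).
  have [a Aa] := A0; have [r ar] := realK _ (Areal _ Aa).
  by case: (leP 0 (sup A')) => [|/ltW]; rewrite -le_iota rmorph0 => h;
    rewrite realE h ?orbT.
split=> [a Aa|b Bb].
  have [r ar] := realK _ (Areal _ Aa).
  by rewrite ar le_iota; apply: ub_le_sup => //; rewrite /A' /= -ar.
have [r br] := realK _ (Breal _ Bb).
rewrite br le_iota; apply: ge_sup => // s As.
by rewrite -le_iota -br; exact: AB.
Qed.

Lemma exists_half_expn_lt (e : K) : 0 < e -> exists k, 2^-1 ^+ k < e.
Proof.
have [iota [le_iota realK]] := real_scalars_embedding => e0.
have [r er] := realK _ (gtr0_real e0).
have lt_iota x y : (iota x < iota y) = (x < y) by exact: (leW_mono le_iota).
have r0 : 0 < r by rewrite -lt_iota rmorph0 -er.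
have /archi_boundP : 0 <= r^-1 by rewrite invr_ge0 ltW.
set k := Num.bound _ => hk; exists k.
have -> : (2^-1 : K) ^+ k = iota (2^-1 ^+ k) by rewrite rmorphXn fmorphV rmorph_nat.
rewrite er lt_iota exprVn invf_plt ?posrE ?exprn_gt0 //.
by apply: lt_le_trans hk _; rewrite -natrX ler_nat ltnW // ltn_expl.
Qed.

End RealScalars.

(** * Subspaces of finite codimension *)

(** The set S of scalars is a parameter because spaces over K are intersected
with hyperplanes which are only real.  The zero vector is not required, so that
the property passes to unions of chains, the empty one included. *)
Definition closed_under_comb (K : numFieldType) (X : lmodType K) (S : set K)
    (E : set X) : Prop :=
  forall a x y, S a -> E x -> E y -> E (a *: x + y).

Section Codimension.
Variables (K : numFieldType) (X : lmodType K).
Implicit Types (S : set K) (W E : set X).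

Lemma vector_subspaceP E : vector_subspace E <-> E 0 /\ closed_under_comb setT E.
Proof.
split=> [[E0 Ecomb]|[E0 Ecomb]]; split.
- by rewrite inE in E0.
- by move=> a x y _ Ex Ey; apply/set_mem/Ecomb; rewrite inE.
- by rewrite inE.
- by move=> a x y; rewrite !inE; exact: Ecomb.
Qed.

(** Enlarging E by a line adds at most one dimension to its trace on W: if
w = e + c v is in W with c nonzero, then every element of W in E + S v differs
from an element of W and E by a multiple of w. *)
Lemma finite_dimensional_setI_adjoin S W E (v : X) :
  S 0 -> (forall a b, S a -> S b -> S (- (a / b))) ->
  closed_under_comb S W -> closed_under_comb S E ->
  finite_dimensional (W `&` E) ->
  finite_dimensional (W `&` [set x | exists2 c, S c & E (x - c *: v)]).
Proof.
move=> S0 Sdiv Wcomb Ecomb [d [u [uWE uspan]]].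
have uWE' i : (W `&` [set x | exists2 c, S c & E (x - c *: v)]) (u i).
  by have [Wu Eu] := uWE i; split => //; exists 0; rewrite // scale0r subr0.
have [[w [Ww [c [Sc c0 Ewc]]]]|noc] :=
    pselect (exists w, W w /\ exists c, [/\ S c, c != 0 & E (w - c *: v)]); last first.
  exists d, u; split => // x [Wx [c Sc Exc]]; apply: uspan; split => //.
  have [c0|c0] := eqVneq c 0; first by rewrite c0 scale0r subr0 in Exc.
  by exfalso; apply: noc; exists x; split => //; exists c.
exists d.+1, (fun i => if unlift ord0 i is Some j then u j else w); split.
  move=> i; case: unliftP => [j|] _ //; split => //.
  by exists c.
move=> x [Wx [c' Sc' Exc]].
have [|a xa] := uspan (- (c' / c) *: w + x).
  split; first by apply: Wcomb => //; exact: Sdiv.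
  have -> : - (c' / c) *: w + x = - (c' / c) *: (w - c *: v) + (x - c' *: v).
    rewrite scalerBr scalerA mulNr divfK // scaleNr scaleNr opprK.
    by rewrite addrACA subrr addr0.
  by apply: Ecomb => //; exact: Sdiv.
exists (fun i => if unlift ord0 i is Some j then a j else c' / c).
rewrite big_ord_recl unlift_none.
under eq_bigr do rewrite liftK.
by rewrite -xa addrA scaleNr subrr add0r.
Qed.

Lemma closed_under_comb_adjoin E (v : X) :
  closed_under_comb setT E ->
  closed_under_comb setT [set x | exists2 c, setT c & E (x - c *: v)].
Proof.
move=> Ecomb a x y _ [c _ Ex] [c' _ Ey]; exists (a * c + c') => //.
rewrite scalerDl -scalerA opprD addrACA -scalerBr.
exact: Ecomb.
Qed.

(** Induction on the codimension: adjoining one vector at a time to E eventually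
gives the whole space, whose trace on W is W. *)
Lemma finite_dimensional_setI_codim W E :
  closed_under_comb setT W -> closed_under_comb setT E ->
  finite_codimensional E -> finite_dimensional (W `&` E) -> finite_dimensional W.
Proof.
move=> Wcomb + [d [v]]; elim: d v E => [|d IH] v E Ecomb Ecodim WEfin.
  suff <- : W `&` E = W by [].
  apply/setIidPl => x _; have [a] := Ecodim x.
  by rewrite big_ord0 subr0.
pose E' := [set x | exists2 c, setT c & E (x - c *: v ord0)].
apply: (IH (v \o lift ord0) E').
- exact: closed_under_comb_adjoin.
- move=> x; have [a Ea] := Ecodim x.
  exists (a \o lift ord0); exists (a ord0) => //.
  by rewrite big_ord_recl /= opprD addrA addrAC in Ea *.
- exact: finite_dimensional_setI_adjoin.
Qed.

Lemma finite_dimensional_setI_real_codim1 W E (v : X) :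
  closed_under_comb [set a | a \is Num.real] W ->
  closed_under_comb [set a | a \is Num.real] E ->
  (forall x, exists2 c, c \is Num.real & E (x - c *: v)) ->
  finite_dimensional (W `&` E) -> finite_dimensional W.
Proof.
move=> Wcomb Ecomb Ecodim WEfin.
suff -> : W = W `&` [set x | exists2 c, c \is Num.real & E (x - c *: v)].
  apply: (@finite_dimensional_setI_adjoin [set a | a \is Num.real]) => //=.
  by move=> a b ar br; rewrite realN realM ?realV.
by apply/esym/setIidPl => x _; exact: Ecodim.
Qed.

End Codimension.

(** * Seminorms *)

Section SeminormTheory.
Variables (K : numFieldType) (X : lmodType K) (p : X -> K).
Hypothesis p_semi : seminorm p.

Lemma seminorm_ge0 x : 0 <= p x. Proof. by have [] := p_semi. Qed.

Lemma ler_seminormD x y : p (x + y) <= p x + p y.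
Proof. by have [] := p_semi. Qed.

Lemma seminormZ a x : p (a *: x) = `|a| * p x.
Proof. by have [] := p_semi. Qed.

Lemma seminorm0 : p 0 = 0.
Proof. by rewrite -[0 in LHS](scale0r 0) seminormZ normr0 mul0r. Qed.

Lemma seminormN x : p (- x) = p x.
Proof. by rewrite -scaleN1r seminormZ normrN1 mul1r. Qed.

Lemma ler_seminormB x y : p (x - y) <= p x + p y.
Proof. by rewrite -[p y]seminormN ler_seminormD. Qed.

Lemma seminorm_real x : p x \is Num.real.
Proof. by rewrite ger0_real ?seminorm_ge0. Qed.

End SeminormTheory.

(** * A Hahn-Banach hyperplane *)

Section HahnBanach.
Variables (R : realType) (K : numFieldType).
Hypothesis hK : real_or_complex R K.
Variables (X : lmodType K) (q : X -> K) (s : X).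
Hypothesis q_semi : seminorm q.

Let real_comb := @closed_under_comb K X [set a | a \is Num.real].
(* For a subspace L: the distance from s to L in the seminorm q is q s. *)
Let far (L : set X) := forall l, L l -> q s <= q (s + l).

Lemma far_scale (L : set X) a l :
  real_comb L -> far L -> L 0 -> a \is Num.real -> L l ->
  `|a| * q s <= q (a *: s + l).
Proof.
move=> Lcomb Lfar L0 ar Ll; have [->|a0] := eqVneq a 0.
  by rewrite normr0 mul0r seminorm_ge0.
have -> : a *: s + l = a *: (s + (a^-1 *: l + 0)).
  by rewrite addr0 scalerDr scalerA divff // scale1r.
rewrite seminormZ // ler_wpM2l //; apply/Lfar/Lcomb => //=.
by rewrite realV.
Qed.

(** The one-step extension.  Writing f for the functional a s + l |-> a q(s), which
q dominates on L + R s, a value c q(s) of f at v keeps it dominated exactly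
when c separates the numbers -q(a s + l + v)/q(s) - a from the numbers
q(a s + l + v)/q(s) - a; then v - c s can be adjoined to the kernel L. *)
Lemma far_adjoin (L : set X) v :
  real_comb L -> far L -> L 0 -> exists2 c, c \is Num.real &
    far [set x | exists2 t, t \is Num.real & L (x - t *: (v - c *: s))].
Proof.
move=> Lcomb Lfar L0; have [qs0|qs0] := eqVneq (q s) 0.
  by exists 0; rewrite // => l _; rewrite qs0 seminorm_ge0.
have qs_gt0 : 0 < q s by rewrite lt0r qs0 seminorm_ge0.
pose lower := [set x | exists a l, [/\ a \is Num.real, L l &
  x = - (q (a *: s + l + v) / q s) - a]].
pose upper := [set x | exists a l, [/\ a \is Num.real, L l &
  x = q (a *: s + l + v) / q s - a]].
have qr x : q x / q s \is Num.real by rewrite realM ?realV ?seminorm_real.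
have [||||x y [a [l [ar Ll ->]]] [b [m [br Lm ->]]]|c cr [clower cupper]] :=
    @real_cut _ _ hK lower upper.
- by move=> _ [a [l [ar Ll ->]]] /=; rewrite realB // realN.
- by move=> _ [a [l [ar Ll ->]]] /=; rewrite realB.
- by exists (- (q (0 *: s + 0 + v) / q s) - 0), 0, 0.
- by exists (q (0 *: s + 0 + v) / q s - 0), 0, 0.
  (* The cut is consistent: the difference of the two arguments of q no longer
     contains v, and its seminorm is controlled on L + R s. *)
- have key : (b - a) * q s <= q (a *: s + l + v) + q (b *: s + m + v).
    have rba : b - a \is Num.real by rewrite realB.
    apply: le_trans (_ : `|b - a| * q s <= _).
      by rewrite ler_wpM2r ?seminorm_ge0 // real_ler_norm.
    apply: le_trans (far_scale Lcomb Lfar L0 rba (_ : L (-1 *: l + m))) _.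
      by apply: Lcomb => //=; rewrite realN.
    rewrite [leRHS]addrC; apply: le_trans (ler_seminormB q_semi _ _).
    rewrite scaleN1r scalerBl.
    suff -> : b *: s + m + v - (a *: s + l + v) =
      b *: s - a *: s + (- l + m) by [].
    rewrite opprD addrACA subrr addr0 opprD addrACA; congr (_ + _).
    exact: addrC.
  rewrite -subr_ge0.
  have -> : q (b *: s + m + v) / q s - b - (- (q (a *: s + l + v) / q s) - a) =
    (q (a *: s + l + v) + q (b *: s + m + v) - (b - a) * q s) / q s by field.
  by rewrite divr_ge0 ?subr_ge0 ?seminorm_ge0.
exists c => // x [t tr Lx].
have [t0|t0] := eqVneq t 0.
  by apply: Lfar; rewrite t0 scale0r subr0 in Lx.
(* Dividing s + x by t gives a vector a s + l + v with a + c = t^-1, and the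
   two sides of the cut at a bound |a + c|. *)
pose a := t^-1 - c.
have ar : a \is Num.real by rewrite realB ?realV.
have [l Ll tl] : exists2 l, L l & t *: l = x - (t *: v - (t * c) *: s).
  exists (t^-1 *: (x - t *: (v - c *: s)) + 0).
    by apply: Lcomb => //=; rewrite realV.
  by rewrite addr0 scalerA divff // scale1r scalerBr scalerA.
have -> : s + x = t *: (a *: s + l + v).
  rewrite !scalerDr tl scalerA /a mulrBr divff // scalerBl scale1r opprB.
  by rewrite !addrA subrK [_ - _ + x]addrAC subrK.
rewrite seminormZ //.
set F := q (_ + v); have F0 : 0 <= F by exact: seminorm_ge0.
have : `|t^-1| <= F / q s.
  have aE : a + c = t^-1 by rewrite subrK.
  rewrite real_ler_norml ?realV // -aE addrC; apply/andP; split.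
    by rewrite -lerBlDr; apply: clower; exists a, l.
  by rewrite -lerBrDr; apply: cupper; exists a, l.
rewrite ler_pdivlMr // normfV ler_pdivrMl ?normr_gt0 //.
Qed.

(** Hahn-Banach without functionals: L plays the part of the kernel of a real
functional f with f s = q s and |f| <= q.  A maximal subspace L with
q s <= q (s + l) on L has the property, by the one-step extension. *)
Lemma hahn_banach_real_hyperplane : exists L : set X,
  [/\ real_comb L, far L &
      forall x, exists2 c, c \is Num.real & L (x - c *: s)].
Proof.
have [F FP Ftot|L [[Lcomb Lfar] Lmax]] :=
    @Zorn_bigcup _ [set L | real_comb L /\ far L].
  split=> [a x y ar [A FA Ax] [B FB By]|l [A FA Al]]; last first.
    by have [_] := FP _ FA; apply.
  have [AB|BA] := Ftot _ _ FA FB.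
    by exists B => //; have [Bcomb _] := FP _ FB; apply: Bcomb => //; exact: AB.
  by exists A => //; have [Acomb _] := FP _ FA; apply: Acomb => //; exact: BA.
(* The empty set is a candidate, but not a maximal one. *)
have L0 : L 0.
  have [L_0|/set0P[l Ll]] := eqVneq L set0; last first.
    by rewrite -(addNr l) -scaleN1r; apply: Lcomb => //=; rewrite realN.
  exfalso; apply: (Lmax [set 0]).
    by rewrite L_0; split => // /(_ 0 erefl).
  split=> [a x y _ /= -> ->|l /= ->]; last by rewrite addr0.
  by rewrite scaler0 addr0.
exists L; split => // v.
have [c cr Bfar] := far_adjoin v Lcomb Lfar L0.
exists c => //.
set B := [set x | _] in Bfar.
have LB : L `<=` B by move=> x Lx; exists 0; rewrite ?real0 // scale0r subr0.
have Bcomb : real_comb B.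
  move=> a x y ar [t tr Lt] [u ur Lu]; exists (a * t + u).
    by rewrite realD // realM.
  by rewrite scalerDl -scalerA opprD addrACA -scalerBr; exact: Lcomb.
suff BL : B `<=` L.
  by apply: BL; exists 1; rewrite ?real1 // scale1r subrr.
apply: contrapT => nBL; apply: (Lmax B) => //.
Qed.

End HahnBanach.

(** * Choosing one term of the series *)

Section Construction.
Variables (R : realType) (K : numFieldType).
Hypothesis hK : real_or_complex R K.

(** Any notion of smallness of codimension will do; it is used for subspaces over K
of finite codimension and for real hyperplanes. *)
Lemma infinite_dimensional_setI_family (X : lmodType K) (S : set K) (W : set X)
    (E : nat -> set X) (b : nat) :
  (forall n, closed_under_comb S (E n)) ->
  (forall n (V : set X), closed_under_comb S V ->
    finite_dimensional (V `&` E n) -> finite_dimensional V) ->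
  closed_under_comb S W -> ~ finite_dimensional W ->
  ~ finite_dimensional (W `&` [set x | forall n, (n < b)%N -> E n x]).
Proof.
move=> Ecomb Efin Wcomb Winf; elim: b => [|b IH] Wfin.
  apply: Winf; suff <- : W `&` [set x | forall n, (n < 0)%N -> E n x] = W by [].
  by apply/setIidPl => x _ n.
apply/IH/(Efin b).
  move=> a x y Sa [Wx Ex] [Wy Ey]; split; first exact: Wcomb.
  by move=> n nb; apply: Ecomb; [|exact: Ex|exact: Ey].
suff <- : W `&` [set x | forall n, (n < b.+1)%N -> E n x] =
    W `&` [set x | forall n, (n < b)%N -> E n x] `&` E b by [].
apply/seteqP; split=> x.
  by move=> [Wx Ex]; split; [split=> // n nb|]; apply: Ex => //; exact: ltnW.
move=> [[Wx Ex] Eb]; split=> // n; rewrite ltnS leq_eqVlt => /predU1P[->//|].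
exact: Ex.
Qed.

(** The step of the construction: s is the partial sum already chosen, and the
hyperplanes L are those attached to s by Hahn-Banach.  The subspaces E, being
spaces over K, have to be intersected before the real subspaces L are. *)
Lemma exists_next_term (X : lmodType K) (M : set X) (E : nat -> set X)
    (Q : nat -> X -> K) (P : X -> K) (s : X) (b : nat) (e : K) :
  vector_subspace M -> ~ finite_dimensional M ->
  (forall n, vector_subspace (E n)) -> (forall n, finite_codimensional (E n)) ->
  (forall n, seminorm (Q n)) -> seminorm P ->
  (forall x, M x -> P x = 0 -> x = 0) -> 0 < e ->
  exists x, [/\ M x, P x = e &
    forall n, (n < b)%N -> E n x /\ Q n s <= Q n (s + x)].
Proof.
move=> /vector_subspaceP[M0 Mcomb] Minf Esub Ecodim Qsemi Psemi Pnorm e0.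
have EP n := (vector_subspaceP (E n)).1 (Esub n).
pose W := M `&` [set x | forall n, (n < b)%N -> E n x].
have W0 : W 0 by split=> // n _; have [] := EP n.
have Wcomb : closed_under_comb setT W.
  move=> a x y _ [Mx Ex] [My Ey]; split; first exact: Mcomb.
  by move=> n nb; apply: (EP n).2 => //; [exact: Ex|exact: Ey].
have Winf : ~ finite_dimensional W.
  apply: (@infinite_dimensional_setI_family _ setT) => //.
    by move=> n; exact: (EP n).2.
  by move=> n V Vcomb; apply: finite_dimensional_setI_codim => //; exact: (EP n).2.
have /choice[L LP] n := hahn_banach_real_hyperplane hK s (Qsemi n).
have Lcomb n : closed_under_comb [set a | a \is Num.real] (L n).
  by have [] := LP n.
have WLinf :
    ~ finite_dimensional (W `&` [set x | forall n, (n < b)%N -> L n x]).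
  apply: (@infinite_dimensional_setI_family _ [set a | a \is Num.real]) => //.
    move=> n V Vcomb; apply: (finite_dimensional_setI_real_codim1 (v := s)) => //.
    by have [] := LP n.
  by move=> a x y _; exact: Wcomb.
have [x [[Wx Lx] x0]] :
    exists x, (W `&` [set x | forall n, (n < b)%N -> L n x]) x /\ x != 0.
  apply: contrapT => noX; apply: WLinf; exists 0, (fun _ => 0).
  split=> [[]//|x WLx]; exists (fun _ => 0); rewrite big_ord0.
  by apply: contrapT => /eqP x0; apply: noX; exists x.
have L0 n : L n 0.
  have [_ _ /(_ 0)[c cr Lc]] := LP n.
  by have := Lcomb n (-1) _ _ _ Lc Lc; rewrite scaleN1r addNr; apply; rewrite /= realN.
have Px0 : 0 < P x.
  rewrite lt0r seminorm_ge0 // andbT; apply: contra_neq x0.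
  by apply: Pnorm; have [] := Wx.
have ar : e / P x \is Num.real by rewrite ger0_real ?divr_ge0 ?ltW.
have [Max Eax] : W ((e / P x) *: x) by rewrite -[_ *: x]addr0; exact: Wcomb.
exists ((e / P x) *: x); split => //.
  by rewrite seminormZ // ger0_norm ?divr_ge0 ?ltW // divfK ?gt_eqF.
move=> n nb; split; first exact: Eax.
have [_ Lfar _] := LP n; apply: Lfar; rewrite -[_ *: x]addr0.
by apply: Lcomb => //; exact: Lx.
Qed.

(** * Summing the series *)

Lemma cvg_seminorm_ge (X : topologicalLmodType K) (Q : X -> K) (u : nat -> X)
    (l : X) (c : K) (k0 : nat) :
  continuous_seminorm Q -> c \is Num.real -> u n @[n --> \oo] --> l ->
  (forall k, (k0 <= k)%N -> c <= Q (u k)) -> c <= Q l.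
Proof.
move=> [Qsemi Qcont] cr ul cQ.
have [//|Qlc] := real_leP cr (seminorm_real Qsemi l).
have Qul : Q (u n) @[n --> \oo] --> Q l by apply: cvg_comp ul _; exact: Qcont.
have e0 : 0 < c - Q l by rewrite subr_gt0.
have [k1 _ k1P] := Qul _ (nbhsx_ballx (Q l) (c - Q l) e0).
have : `|Q l - Q (u (maxn k0 k1))| < c - Q l by exact: k1P (leq_maxr _ _).
rewrite distrC real_ltr_norml ?realB ?seminorm_real // => /andP[_].
by rewrite ltrD2r => /lt_geF; rewrite cQ ?leq_maxl.
Qed.

(** The factor 2 pays for the halving of the bound by the earlier terms, and
2 ^+ k for the size 2^-k of the k-th term.  The condition k <= b k makes each
p_m be dominated by p_(b k) for large k. *)
Lemma block_indices (C : nat -> K) (N : nat) :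
  C n @[n --> \oo] --> +oo -> exists b : nat -> nat,
    [/\ (N <= b 0)%N, {homo b : j k / (j <= k)%N}, forall k, (k <= b k)%N &
        forall k n, (b k <= n)%N -> 2 * 2 ^+ k <= C n].
Proof.
move=> Coo.
have /choice[f fP] k : exists m, forall n, (m <= n)%N -> 2 * 2 ^+ k <= C n.
  have [|m _ mP] := Coo [set x | 2 * 2 ^+ k <= x].
    exists (2 * 2 ^+ k); split; first by rewrite ger0_real // mulr_ge0 ?exprn_ge0.
    by move=> x /ltW.
  by exists m => n mn; exact: mP.
pose b k := (N + \sum_(j < k.+1) (f j).+1)%N.
have bS k : b k.+1 = (b k + (f k.+1).+1)%N by rewrite /b big_ord_recr /= addnA.
exists b; split.
- exact: leq_addr.
- by apply: homo_leq => //; [exact: leq_trans|move=> k; rewrite bS leq_addr].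
- elim=> // k IH; rewrite bS -addn1 leq_add //.
- move=> k n bn; apply: fP; apply: leq_trans bn.
  by rewrite /b big_ord_recr /= addnA; exact: leq_trans (leqnSn _) (leq_addl _ _).
Qed.

Lemma increasing_seminorms_le (X : Type) (p : nat -> X -> K) (m n : nat) x :
  increasing_seminorms p -> (m <= n)%N -> p m x <= p n x.
Proof.
move=> p_incr; apply: (homo_leq (f := p ^~ x) (r := <=%R)) => //.
by move=> y a b; exact: le_trans.
Qed.

(** A neighbourhood {p_N < e} of 0 on which r < 1 contains the whole space ker p_N,
and a seminorm bounded on a subspace vanishes there. *)
Lemma continuous_seminorm_ker (X : topologicalLmodType K) (p : nat -> X -> K)
    (r : X -> K) :
  (forall n, seminorm (p n)) -> increasing_seminorms p ->
  defines_topology p -> continuous_seminorm r ->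
  exists N, forall x, p N x = 0 -> r x = 0.
Proof.
move=> p_semi p_incr p_top [r_semi r_cont].
have : nbhs 0 (r @^-1` ball (r 0) 1) by apply: r_cont; exact: nbhsx_ballx.
move=> /p_top[s [e e0 sub]]; exists (\max_(i <- s) i)%N => x px0.
apply: contraPeq px0 => rx0 px0.
have rx_gt0 : 0 < r x by rewrite lt0r rx0 seminorm_ge0.
(* The vector below is in ker p_N, but r takes the value 2 at it. *)
have : `|r 0 - r ((2 / r x) *: x)| < 1.
  apply: sub => i si; rewrite subr0 seminormZ //.
  suff -> : p i x = 0 by rewrite mulr0.
  apply/le_anti; rewrite seminorm_ge0 // andbT -px0.
  by apply: increasing_seminorms_le => //; exact: leq_bigmax_seq.
rewrite seminormZ // [`|2 / _|]ger0_norm ?divr_ge0 ?ltW // divfK ?gt_eqF //.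
by rewrite seminorm0 // sub0r normrN normr_nat ltrn1.
Qed.

(** The terms g (k, u k) of the series are chosen recursively, since the hyperplanes
that constrain a term depend on the sum u k of the terms before it. *)
Lemma exists_vector_bounded_below (X : topologicalLmodType K)
    (p Q : nat -> X -> K) (M : set X) (E : nat -> set X) (C : nat -> K) (N : nat) :
  (forall n, seminorm (p n)) -> increasing_seminorms p -> defines_topology p ->
  (forall u : nat -> X, cauchy_seq u -> exists l : X, u n @[n --> \oo] --> l) ->
  vector_subspace M -> closed M -> ~ finite_dimensional M ->
  (forall x, M x -> p N x = 0 -> x = 0) ->
  (forall n, vector_subspace (E n)) -> (forall n, finite_codimensional (E n)) ->
  C n @[n --> \oo] --> +oo -> (forall n, continuous_seminorm (Q n)) ->
  (forall n x, E n x -> C n * p n x <= Q n x) ->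
  exists2 l, M l & exists n0, forall n, (n0 <= n)%N -> 1 <= Q n l.
Proof.
move=> p_semi p_incr p_top X_complete Msub Mclosed Minf pN_norm Esub Ecodim Coo
  Q_cont CQ.
have Q_semi n : seminorm (Q n) by have [] := Q_cont n.
have [b [bN b_mono kb Cb]] := block_indices N Coo.
have /choice[g gP] (ks : nat * X) : exists x, [/\ M x,
    p (b ks.1) x = 2^-1 ^+ ks.1 & forall n, (n < b ks.1.+1)%N ->
    E n x /\ Q n ks.2 <= Q n (ks.2 + x)].
  apply: exists_next_term => //.
  move=> x Mx pbx; apply: pN_norm => //; apply/le_anti.
  rewrite seminorm_ge0 // andbT -pbx; apply: increasing_seminorms_le => //.
  by apply: leq_trans bN _; exact: b_mono.
pose u := fix u k := if k is j.+1 then u j + g (j, u j) else 0.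
have uS k : u k.+1 = u k + g (k, u k) by [].
have Mu k : M (u k).
  have [M0 Mcomb] := (vector_subspaceP M).1 Msub.
  elim: k => [//|k IH]; rewrite uS addrC -[g _]scale1r.
  by apply: Mcomb => //; have [] := gP (k, u k).
have Qu_mono n j k : (n < b j.+1)%N -> (j <= k)%N -> Q n (u j) <= Q n (u k).
  move=> nb; elim: k => [|k IH]; first by rewrite leqn0 => /eqP->.
  rewrite leq_eqVlt => /predU1P[->//|]; rewrite ltnS => jk.
  apply: le_trans (IH jk) _; rewrite uS; have [_ _ gQ] := gP (k, u k).
  by apply: (gQ n _).2; apply: leq_trans nb _; exact: b_mono.
have Qu_ge n k : (b k <= n)%N -> (n < b k.+1)%N -> 1 <= Q n (u k.+1).
  move=> bn nb; have [_ pg /(_ n nb)[/= Eg Qg]] := gP (k, u k).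
  have two0 : 0 < 2 :> K by [].
  rewrite -(ler_pM2l two0) mulr1.
  have {1}-> : 2 = 2 * 2 ^+ k * 2^-1 ^+ k :> K.
    by rewrite exprVn mulfK // expf_neq0.
  rewrite -pg; apply: le_trans (_ : C n * p n (g (k, u k)) <= _).
    apply: ler_pM; rewrite ?mulr_ge0 ?exprn_ge0 ?seminorm_ge0 ?Cb //.
    exact: increasing_seminorms_le.
  apply: le_trans (CQ _ _ Eg) _.
  have gE : g (k, u k) = u k.+1 - u k by rewrite uS addrAC subrr add0r.
  rewrite [X in Q n X <= _]gE.
  apply: le_trans (ler_seminormB (Q_semi n) _ _) _.
  by rewrite mulr_natl mulr2n uS lerD2l.
(* The block of n is found as the least k with n < b (k+1). *)
have Qu_ev n : (b 0 <= n)%N -> exists k0, forall k, (k0 <= k)%N -> 1 <= Q n (u k).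
  move=> bn; have nb : exists k, (n < b k.+1)%N by exists n; exact: kb.
  case: (ex_minnP nb) => k nbk kmin; exists k.+1 => j kj.
  apply: le_trans (Qu_ge n k _ nbk) (Qu_mono n k.+1 j _ kj); last first.
    by apply: leq_trans nbk _; exact: b_mono.
  case: k {nbk kj} kmin => // k kmin; rewrite leqNgt; apply/negP => /kmin.
  by rewrite ltnn.
(* The factor 2 is the sum of the geometric series of ratio 1/2. *)
have u_dist m j d : (m <= j)%N ->
    p m (u (j + d)%N - u j) <= 2 * (2^-1 ^+ j - 2^-1 ^+ (j + d)).
  move=> mj; elim: d => [|d IH].
    by rewrite addn0 !subrr mulr0 seminorm0.
  rewrite addnS uS addrAC; apply: le_trans (ler_seminormD (p_semi m) _ _) _.
  have -> : 2 * (2^-1 ^+ j - 2^-1 ^+ (j + d).+1) =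
      2 * (2^-1 ^+ j - 2^-1 ^+ (j + d)) + 2^-1 ^+ (j + d) :> K.
    by rewrite exprS; field.
  apply: lerD IH _; have [_ /= <- _] := gP ((j + d)%N, u (j + d)%N).
  apply: increasing_seminorms_le => //.
  by apply: leq_trans mj _; apply: leq_trans (kb _); exact: leq_addr.
have u_cauchy : cauchy_seq u.
  move=> U /p_top[s [e e0 sub]].
  have [k1 k1e] := exists_half_expn_lt hK (divr_gt0 e0 (ltr0n K 2)).
  pose m := (\max_(i <- s) i)%N.
  have close j k : (maxn m k1 <= j)%N -> (j <= k)%N -> p m (u k - u j) < e.
    rewrite geq_max => /andP[mj kj] /subnKC <-.
    apply: le_lt_trans (u_dist _ _ _ mj) _.
    rewrite mulrC -ltr_pdivlMr //; apply: le_lt_trans k1e.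
    apply: le_trans (_ : 2^-1 ^+ j <= _).
      by rewrite lerBlDr lerDl exprn_ge0 // invr_ge0.
    by apply: ler_wiXn2l; rewrite ?invr_ge0 // invf_le1 // ler1n.
  exists (maxn m k1) => j k mj mk; apply: sub => i si; rewrite subr0.
  apply: le_lt_trans (_ : p m (u j - u k) < e).
    by apply: increasing_seminorms_le => //; exact: leq_bigmax_seq.
  have [jk|/ltnW kj] := leqP j k; last exact: close.
  by rewrite -opprB seminormN // close.
have [l ul] := X_complete _ u_cauchy; exists l.
  by apply: (closed_cvg M Mclosed _ l ul); exact: nearW.
exists (b 0) => n /Qu_ev[k0 Qk0].
exact: cvg_seminorm_ge (Q_cont n) (real1 _) ul Qk0.
Qed.

(** * Density of orbits *)

(** Since q may vanish at some of the first terms, and takes arbitrary values at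
the others, one looks for e such that q takes no value in ]0, e[ along the
sequence; a multiple of y n0 has q-value e / 2. *)
Lemma not_dense_seminorm_ge1 (Y : topologicalLmodType K) (q : Y -> K)
    (y : nat -> Y) (n0 : nat) :
  continuous_seminorm q -> (forall n, (n0 <= n)%N -> 1 <= q (y n)) ->
  ~ dense (range y).
Proof.
move=> [q_semi q_cont] qy ydense.
have [e e0 gap] : exists2 e, 0 < e & forall n, q (y n) = 0 \/ e <= q (y n).
  suff [e e0 gap] : exists2 e, 0 < e <= 1 &
      forall n, (n < n0)%N -> q (y n) = 0 \/ e <= q (y n).
    move/andP: e0 => [e0 e1]; exists e => // n.
    by have [/gap//|/qy/(le_trans e1)] := ltnP n n0; right.
  elim: n0 {qy} => [|m [e /andP[e0 e1] gap]]; first by exists 1; rewrite ?ltr01 /=.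
  have [qm0|qm0] := eqVneq (q (y m)) 0.
    exists e; rewrite ?e0 // => n; rewrite ltnS leq_eqVlt.
    by move=> /predU1P[->|/gap//]; left.
  have qm_gt0 : 0 < q (y m) by rewrite lt0r qm0 seminorm_ge0.
  have [em|me] := real_leP (gtr0_real e0) (seminorm_real q_semi (y m)).
    exists e; rewrite ?e0 // => n; rewrite ltnS leq_eqVlt.
    by move=> /predU1P[->|/gap//]; right.
  exists (q (y m)); first by rewrite qm_gt0 (le_trans (ltW me)).
  move=> n; rewrite ltnS leq_eqVlt => /predU1P[->|/gap[|h]]; [by right|by left|].
  by right; exact: le_trans (ltW me) h.
pose z := (e / 2 / q (y n0)) *: y n0.
have qy0 : 0 < q (y n0) by exact: lt_le_trans (qy _ (leqnn _)).
have e20 : 0 < e / 2 by rewrite divr_gt0.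
have qz : q z = e / 2.
  by rewrite seminormZ // ger0_norm ?divr_ge0 ?ltW // divfK ?gt_eqF.
have zO : nbhs z (q @^-1` ball (q z) (e / 2)).
  by apply: q_cont; exact: nbhsx_ballx.
have [w [wO [n _ yn]]] := ydense _ (ex_intro _ z zO) (open_interior _).
have : `|q z - q (y n)| < e / 2 by rewrite yn; exact: (interior_subset wO).
rewrite qz; have [->|h] := gap n.
  by rewrite subr0 gtr0_norm // ltxx.
rewrite distrC ger0_norm.
  by rewrite ltrBlDr -splitr => /lt_geF; rewrite h.
by rewrite subr_ge0; apply: le_trans h; rewrite ler_pdivrMr // ler_peMr ?ler1n // ltW.
Qed.

End Construction.

Theorem theorem1p13 (R : realType) (K : numFieldType)
  (hK : real_or_complex R K)
  (X Y : topologicalLmodType K) (hX : frechet_space X)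
  (p : nat -> X -> K) (hp : forall n, seminorm (p n))
  (hp_incr : increasing_seminorms p) (hp_top : defines_topology p)
  (hY_sep : separable_space Y)
  (hY : exists2 r : nat -> Y -> K,
          (forall n, seminorm (r n)) & defines_topology r)
  (T : nat -> {linear X -> Y}) (hT : forall n, continuous (T n))
  (hE : exists (E : nat -> set X) (C : nat -> K) (q : Y -> K),
      [/\ forall n, [/\ vector_subspace (E n), closed (E n) &
                        finite_codimensional (E n)],
          forall n, 0 < C n,
          C n @[n --> \oo] --> +oo,
          continuous_seminorm q &
          forall n x, E n x -> q (T n x) >= C n * p n x]) :
  ~ exists M : set X, hypercyclic_subspace_type1 T M.
Proof.
move=> [M [[Msub Mclosed Minf Mhyp] [r r_semi Mr]]].
have [E [C [q [EP C0 Coo [q_semi q_cont] Cq]]]] := hE.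
have [N pN_ker] := continuous_seminorm_ker hp hp_incr hp_top r_semi.
have [_ _ X_complete] := hX.
pose Q n x := q (T n x).
have Q_cont n : continuous_seminorm (Q n).
  split; last by move=> x; apply: continuous_comp; [exact: hT|exact: q_cont].
  split=> [x|x y|a x]; rewrite /Q ?linearD ?linearZ; first exact: seminorm_ge0.
    exact: ler_seminormD.
  exact: seminormZ.
have [|||l Ml [n0 Ql]] := exists_vector_bounded_below hK (Q := Q) (E := E) (N := N)
    hp hp_incr hp_top X_complete Msub Mclosed Minf _ _ _ Coo Q_cont Cq.
- move=> x Mx /pN_ker rx0; have : (M `&` [set x | r x = 0]) x by [].
  by rewrite Mr.
- by move=> n; have [] := EP n.
- by move=> n; have [] := EP n.
have qTl n : (n0 <= n)%N -> 1 <= q (T n l) by exact: Ql.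
apply: (not_dense_seminorm_ge1 (conj q_semi q_cont) qTl); apply: Mhyp => //.
apply: contraPneq (qTl n0 (leqnn _)) => ->.
by rewrite linear0 seminorm0 // ler10.
Qed.
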